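(* Let $\mathcal{Z}_{10}(x)$ be the set of base-$10$ Zuckerman numbers not exceeding $x$. Then $$|\mathcal{Z}_{10}(x)| > x^{0.204}$$ as $x \to +\infty$, i.e. for all sufficiently large real $x$.
   Context: A positive integer $n$ is a base-$10$ Zuckerman number if $n$ is divisible by the product of its decimal digits (a number having a digit $0$ is not a Zuckerman number, since its digit product is $0$). *)

(* Defs.v *)
From HB Require Import structures.
From mathcomp Require Import all_boot all_order all_algebra.
From mathcomp Require Import finmap.
From mathcomp Require Import all_classical all_reals all_analysis.
Set Implicit Arguments.
Unset Strict Implicit.
Unset Printing Implicit Defensive.
Import Order.TTheory GRing.Theory Num.Theory.
Import numFieldNormedType.Exports.

(* The base-b representation of n > 0 has exactly [trunc_log b n + 1] digits
   (for 1 < b), and its digit of weight b ^ i is [n %/ b ^ i %% b]. *)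
Definition digit_prod (b n : nat) : nat :=
  \prod_(i < (trunc_log b n).+1) (n %/ b ^ i %% b).

(* If some digit is 0 then [digit_prod b n = 0], and [0 %| n] fails for n > 0. *)
Definition zuckerman (b n : nat) : bool := (0 < n) && (digit_prod b n %| n).

Local Open Scope classical_set_scope.
Local Open Scope ring_scope.

Definition zuckerman_upto (R : realType) (b : nat) (x : R) : set nat :=
  [set n : nat | zuckerman b n /\ n%:R <= x].

(* [fset_set] sends infinite sets to the empty set; this lemma shows that it is
   only ever applied here to a finite set. *)
Lemma finite_zuckerman_upto (R : realType) (b : nat) (x : R) :
  finite_set (zuckerman_upto b x).
Proof.
apply: (@sub_finite_set _ _ `I_(Num.truncn x).+1); last exact: finite_II.
move=> n [_ nx] /=; rewrite -(ltr_nat R).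
exact: le_lt_trans nx (truncnS_gt x).
Qed.

Definition zuckerman_count (R : realType) (b : nat) (x : R) : nat :=
  #|` fset_set (zuckerman_upto b x)|%fset.

(* Main.v *)
(* Take numbers with digits 1, 2, 4 only. Their divisibility by 2^k depends only
   on the k lowest digits, so a number is built from both ends: keep a low part t
   whose value is divisible by 2^|t|, a high part u, and a balance
   b = |t| - (exponent of 2 in the digits of t and u) that never gets negative.
   Placing a digit 2^v at the high end costs v units of balance and is
   unconstrained; adding it at the low end changes the balance by 1 - v, but the
   parity of 2^v is forced by that of y = 5^|t| (value of t) / 2^|t|. The next
   value of y is known mod 4 up to one bit. Taking the worst case for that bit
   leaves a finite system, on b in {0, 1, 2} and y mod 4, in which the number of
   completions still grows by a factor at least 21/13 per digit, and
   log_10 (21/13) > 6/29 > 0.204. *)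
Require Import Defs.
From HB Require Import structures.
From mathcomp Require Import all_boot all_order all_algebra.
From mathcomp Require Import finmap.
From mathcomp Require Import all_classical all_reals all_analysis.
From mathcomp Require Import zify ring lra.
Set Implicit Arguments.
Unset Strict Implicit.
Unset Printing Implicit Defensive.
Import Order.TTheory GRing.Theory Num.Theory.
Import numFieldNormedType.Exports.
Local Open Scope classical_set_scope.
Local Open Scope ring_scope.

(** * Decimal words whose digits are powers of two *)

Section PowerOfTwoWords.
Local Open Scope nat_scope.

(* A word lists the exponents of its digits 1, 2, 4, 8, units digit first. *)
Definition word_val (s : seq nat) : nat :=
  foldr (fun v n => 2 ^ v + 10 * n) 0 s.

Lemma word_val_cat s1 s2 :
  word_val (s1 ++ s2) = word_val s1 + 10 ^ size s1 * word_val s2.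
Proof.
elim: s1 => [|v s1 IH] /=; first by rewrite expn0 mul1n.
by rewrite IH expnS; ring.
Qed.

Lemma word_val_rcons s v :
  word_val (rcons s v) = word_val s + 10 ^ size s * 2 ^ v.
Proof. by rewrite -cats1 word_val_cat /= muln0 addn0. Qed.

Lemma exp2_digit v : v < 4 -> 0 < 2 ^ v < 10.
Proof. by case: v => [|[|[|[|]]]]. Qed.

Lemma word_val_bounds s : s != [::] -> all (gtn 4) s ->
  10 ^ (size s).-1 <= word_val s < 10 ^ size s.
Proof.
elim: s => [//|v s IH] _ /= /andP[/exp2_digit vlt alls].
case: s IH alls => [|w s] IH alls; first by rewrite /= expn1; lia.
by have /= := IH isT alls; rewrite !expnS; lia.
Qed.

Lemma trunc_log_word s : s != [::] -> all (gtn 4) s ->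
  trunc_log 10 (word_val s) = (size s).-1.
Proof.
move=> s0 alls; apply: trunc_log_eq => //.
by rewrite prednK ?lt0n ?size_eq0 // word_val_bounds.
Qed.

Lemma digit_word s i : all (gtn 4) s -> i < size s ->
  word_val s %/ 10 ^ i %% 10 = 2 ^ nth 0 s i.
Proof.
elim: s i => [//|v s IH] [|i] /= /andP[/exp2_digit vlt alls] ilt.
  by rewrite expn0 divn1; lia.
rewrite expnS divnMA -IH //.
by congr (_ %/ _ %% _); lia.
Qed.

Lemma digit_prod_word s : s != [::] -> all (gtn 4) s ->
  digit_prod 10 (word_val s) = 2 ^ sumn s.
Proof.
move=> s0 alls; rewrite /digit_prod trunc_log_word //.
rewrite prednK ?lt0n ?size_eq0 //.
rewrite (eq_bigr (fun i : 'I_(size s) => 2 ^ nth 0 s i)); last first.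
  by move=> i _; rewrite digit_word.
by rewrite -expn_sum sumnE (big_nth 0) big_mkord.
Qed.

Lemma zuckerman_word s : s != [::] -> all (gtn 4) s ->
  2 ^ sumn s %| word_val s -> zuckerman 10 (word_val s).
Proof.
move=> s0 alls dvd; rewrite /zuckerman digit_prod_word // dvd andbT.
have /andP[+ _] := word_val_bounds s0 alls.
by apply: leq_trans; rewrite expn_gt0.
Qed.

Lemma word_val_inj s1 s2 : size s1 = size s2 ->
  all (gtn 4) s1 -> all (gtn 4) s2 -> word_val s1 = word_val s2 -> s1 = s2.
Proof.
move=> sz all1 all2 eqv; apply: (eq_from_nth (x0 := 0) sz) => i ilt.
apply/eqP; rewrite -(eqn_exp2l _ _ (isT : 1 < 2)) -!digit_word -?sz //.
by rewrite eqv.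
Qed.

(** * Growth of the number of completions *)

(** Injectivity of [f] in both arguments makes the families for different [v] disjoint, so their
    sizes add up. *)
Lemma gather_words (f : nat -> seq nat -> seq nat) (P : pred (seq nat))
    (w : nat -> nat) (K : nat) (vs : seq nat) :
  (forall v v' m m', f v m = f v' m' -> v = v' /\ m = m') -> uniq vs ->
  (forall v, v \in vs ->
     exists L, [/\ uniq L, all (P \o f v) L & w v <= K * size L]) ->
  exists L, [/\ uniq L, all P L & \sum_(v <- vs) w v <= K * size L].
Proof.
move=> finj vsu H.
have /choice [L HL] : forall v, exists L, v \in vs ->
    [/\ uniq L, all (P \o f v) L & w v <= K * size L].
  move=> v; case: (boolP (v \in vs)) => [/H[L ?]|_]; first by exists L.
  by exists [::].
exists [seq f v m | v <- vs, m <- L v]; split.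
- apply: allpairs_uniq_dep => //; first by move=> v /HL[].
  by move=> [v m] [v' m'] _ _ /= /finj[-> ->].
- by apply/allP => _ /allpairsPdep[v [m [/HL[_ /allP Pm _] /Pm Pfm ->]]].
- rewrite size_allpairs_dep sumnE big_map big_distrr /= !big_seq.
  by apply: leq_sum => v /HL[].
Qed.

(* Found by iterating the max-min operator of [weight_step] and rounding; its
   optimal growth rate is the golden ratio, of which 21/13 is a convergent. *)
Definition weight (b c : nat) : nat :=
  nth 0 (nth [::] [:: [:: 4; 13; 0; 8];
                      [:: 13; 28; 13; 21];
                      [:: 36; 66; 34; 46]] (minn b 2)) c.

(** A low digit gains one unit of balance before paying [v]; the parity test makes the next power of
    2 divide the low part. *)
Definition low_moves (b c : nat) : seq nat :=
  [seq v <- iota 0 3 | (v <= b.+1) && ~~ odd (c + 2 ^ v)].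

(** A check of the twelve states: in each, the moves at one of the two ends suffice. The [minn] is
    the worst case for the unknown bit of y. *)
Lemma weight_step b c : b < 3 -> c < 4 ->
  21 * weight b c <= 13 * (\sum_(v <- iota 0 b.+1) weight (b - v) c) \/
  21 * weight b c <= 13 * (\sum_(v <- low_moves b c)
     let h := (c + 2 ^ v)./2 %% 2 in
     minn (weight (b.+1 - v) h) (weight (b.+1 - v) h.+2)).
Proof.
case: b => [|[|[|//]]] _; case: c => [|[|[|[|//]]]] _;
  rewrite /low_moves /= unlock /=; (left; done) || (right; done).
Qed.

Lemma weight_le b c : weight b c <= 66.
Proof.
rewrite /weight; have : minn b 2 < 3 by lia.
by case: (minn b 2) => [|[|[|//]]] _; case: c => [|[|[|[|[]]]]].
Qed.

(* The factor 5^k makes the transition y' = 5 (y + 25^k 2^v) / 2 independent of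
   k modulo 4, since 25^k = 1 mod 8. *)
Lemma low_step k t v y :
  5 ^ k * t = 2 ^ k * y -> ~~ odd (y %% 4 + 2 ^ v) ->
  let h := (y %% 4 + 2 ^ v)./2 %% 2 in
  exists y', 5 ^ k.+1 * (t + 10 ^ k * 2 ^ v) = 2 ^ k.+1 * y' /\
             (y' %% 4 = h \/ y' %% 4 = h.+2).
Proof.
move=> ty; set d := 2 ^ v => ev h.
have [j j25] : exists j, 25 ^ k = 1 + 8 * j.
  elim: k {ty} => [|k [j IH]]; first by exists 0.
  by exists (3 + 25 * j); rewrite expnS IH; lia.
pose z := y + d * 25 ^ k.
have zE : z = y + d + 8 * (d * j) by rewrite /z j25; ring.
have z2 : z = 2 * z./2 by move: ev; rewrite zE; lia.
(* [z] is known mod 4, hence [z./2] only mod 2: this is the undetermined bit. *)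
exists (5 * z./2); split; last by move: ev; rewrite /h; lia.
rewrite mulnDr expnS -mulnA ty.
have -> : 10 ^ k = 2 ^ k * 5 ^ k by rewrite -expnMn.
have e25 : 25 ^ k = 5 ^ k * 5 ^ k by rewrite -expnMn.
transitivity (2 ^ k * 5 * z); first by rewrite /z e25; ring.
by rewrite {1}z2 expnS; ring.
Qed.

(** Induction on the number of missing digits, fixing one digit at the end that [weight_step]
    selects. The constant 66 bounds every weight, which settles [r = 0]. *)
Lemma many_completions r t u b y :
  5 ^ size t * word_val t = 2 ^ size t * y ->
  sumn t + sumn u + b <= size t ->
  exists L : seq (seq nat), [/\ uniq L,
    all (fun m => [&& size m == r, all (gtn 4) m
                    & 2 ^ sumn (t ++ m ++ u) %| word_val (t ++ m ++ u)]) L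
    & weight b (y %% 4) * 21 ^ r <= 66 * 13 ^ r * size L].
Proof.
elim: r t u b y => [|r IH] t u b y ty bal.
  exists [:: [::]]; split=> //=; last by rewrite !expn0 !muln1 weight_le.
  rewrite andbT word_val_cat sumn_cat.
  (* The balance is nonnegative, so divisibility by [2 ^ size t] is enough. *)
  apply: (@dvdn_trans (2 ^ size t)); first by rewrite dvdn_exp2l //; lia.
  apply: dvdn_add.
    have co : coprime (2 ^ size t) (5 ^ size t) by rewrite coprimeXl ?coprimeXr.
    by rewrite -(Gauss_dvdr _ co) ty dvdn_mulr.
  have -> : 10 ^ size t = 2 ^ size t * 5 ^ size t by rewrite -expnMn.
  by rewrite -mulnA dvdn_mulr.
wlog b3 : b bal / b < 3.
  move=> wl; have -> : weight b = weight (minn b 2) by rewrite /weight -minnA.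
  by apply: wl; lia.
set P := (X in all X).
have finish (vs : seq nat) (f : nat -> seq nat -> seq nat) w :
    (forall v v' m m', f v m = f v' m' -> v = v' /\ m = m') -> uniq vs ->
    (forall v, v \in vs ->
       exists L, [/\ uniq L, all (P \o f v) L
                   & w v * 21 ^ r <= 66 * 13 ^ r * size L]) ->
    21 * weight b (y %% 4) <= 13 * (\sum_(v <- vs) w v) ->
    exists L, [/\ uniq L, all P L
      & weight b (y %% 4) * 21 ^ r.+1 <= 66 * 13 ^ r.+1 * size L].
  move=> finj vsu H le; have [L [uL PL sL]] := gather_words finj vsu H.
  exists L; split=> //; move: sL; rewrite -big_distrl /= => sL.
  rewrite !expnS; nia.
have [high|low] := weight_step b3 (ltn_pmod y (isT : 0 < 4)).
(* High end: [t] and [y] stay the same, only the balance drops. *)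
- apply: (finish _ (fun v m => rcons m v) _ _ _ _ high) => [v v' m m'||v].
  + by case/rcons_inj.
  + exact: iota_uniq.
  + rewrite mem_iota => vlt.
    have [|L [uL PL sL]] := IH t (v :: u) (b - v) y ty.
      by rewrite /=; lia.
    exists L; split=> //; apply: sub_all PL => m /and3P[/eqP szm allm dvd].
    rewrite /P /= size_rcons szm eqxx all_rcons allm cat_rcons dvd !andbT /=.
    by lia.
- apply: (finish _ cons _ _ _ _ low) => [v v' m m' []//||v].
  + by rewrite filter_uniq ?iota_uniq.
  + rewrite mem_filter mem_iota => /andP[/andP[vb ev] v3].
    have [y' [ty' y'4]] := low_step ty ev.
    have [||L [uL PL sL]] := IH (rcons t v) u (b.+1 - v) y'.
    * by rewrite word_val_rcons size_rcons.
    * by rewrite sumn_rcons size_rcons; lia.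
    exists L; split=> //.
      apply: sub_all PL => m; rewrite cat_rcons => /and3P[/eqP szm allm dvd].
      by rewrite /P /= szm eqxx allm dvd !andbT; lia.
    (* Whichever residue [y'] has, its weight is at least the minimum. *)
    apply: leq_trans sL; rewrite leq_mul2r; apply/orP; right.
    by case: y'4 => ->; rewrite /= geq_min leqnn ?orbT.
Qed.

Lemma many_words n : exists L : seq (seq nat), [/\ uniq L,
  all (fun s => [&& size s == n, all (gtn 4) s & 2 ^ sumn s %| word_val s]) L
  & 4 * 21 ^ n <= 66 * 13 ^ n * size L].
Proof.
(* Both ends start empty, with balance 0 and [y = 0], a state of weight 4. *)
have [//|//|L [uL PL sL]] := @many_completions n [::] [::] 0 0.
by exists L; split=> //; apply: sub_all PL => s /=; rewrite cats0.
Qed.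

End PowerOfTwoWords.

(** * From words to the counting function *)

Lemma zuckerman_count_ge (R : realType) (n : nat) (x : R) :
  10 ^+ n.+1 <= x ->
  4 / 66 * (21 / 13) ^+ n.+1 <= (zuckerman_count 10 x)%:R :> R.
Proof.
move=> nx; have [L [uL PL sL]] := many_words n.+1.
have sizeL : (size L <= zuckerman_count 10 x)%N.
  rewrite /zuckerman_count.
  have <- : #|` [fset k in map word_val L]%fset| = size L.
    rewrite card_fseq undup_id ?size_map // map_inj_in_uniq // => s1 s2.
    move=> /(allP PL)/and3P[/eqP sz1 all1 _] /(allP PL)/and3P[/eqP sz2 all2 _].
    by apply: word_val_inj; rewrite ?sz1.
  apply/fsubset_leq_card/fsubsetP => k; rewrite inE /=.
  case/mapP => s /(allP PL)/and3P[/eqP szs alls dvd] ->.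
  have s0 : s != [::] by rewrite -size_eq0 szs.
  rewrite in_fset_set; last exact: finite_zuckerman_upto.
  rewrite inE; split; first exact: zuckerman_word.
  apply: le_trans nx; rewrite -natrX ler_nat -szs.
  by have /andP[_ /ltnW] := word_val_bounds s0 alls.
apply: le_trans (_ : (size L)%:R <= _); last by rewrite ler_nat.
move: sL; rewrite -(ler_nat R) !natrM !natrX => sL.
rewrite expr_div_n mulrA ler_pdivrMr ?exprn_gt0 // mulrC.
by lra.
Qed.

(* 6/29 > 0.204, while (21/13)^29 > 10^6. *)
Lemma zuckerman_count_powR (R : realType) (x : R) :
  10 <= x -> x `^ (6 / 29) <= 165 * (zuckerman_count 10 x)%:R.
Proof.
move=> x10; have x0 : 0 <= x by lra.
have [n /andP[nx xn]] : exists n, (10 ^+ n.+1 <= x) && (x < 10 ^+ n.+2).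
  have t10 : (10 <= Num.truncn x)%N by rewrite truncn_ge_nat.
  pose n := (trunc_log 10 (Num.truncn x)).-1.
  have t0 : (0 < Num.truncn x)%N by lia.
  have := trunc_log_bounds (isT : (1 < 10)%N) t0.
  have nE : trunc_log 10 (Num.truncn x) = n.+1.
    by rewrite /n prednK // trunc_log_gt0.
  rewrite nE => /andP[lo hi]; exists n; apply/andP; split.
    by rewrite -natrX -truncn_ge_nat.
  by rewrite -natrX -truncn_lt_nat.
apply: le_trans (ler_wpM2l _ (zuckerman_count_ge nx)); last by lra.
have root : 10 `^ (6 / 29) <= 21 / 13 :> R.
  have -> : 21 / 13 = ((21 / 13) ^+ 29) `^ (29^-1) :> R.
    by rewrite -powR_mulrn; [rewrite -powRrM mulfV ?powRr1 //; lra|lra].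
  rewrite powRrM powR_mulrn; last by lra.
  by rewrite ge0_ler_powR ?nnegrE ?invr_ge0 ?exprn_ge0 //; lra.
have step : x `^ (6 / 29) <= (21 / 13) ^+ n.+2.
  apply: le_trans (_ : (10 ^+ n.+2) `^ (6 / 29) <= _).
    by apply: ge0_ler_powR; rewrite ?nnegrE ?exprn_ge0 ?(ltW xn).
  rewrite -powR_mulrn // -powRrM mulrC powRrM powR_mulrn ?powR_ge0 //.
  by rewrite lerXn2r ?nnegrE ?powR_ge0 //; lra.
(* 165 * 4 / 66 = 10 exceeds 21/13, the factor lost between exponents [n.+1] and [n.+2]. *)
apply: le_trans step _; rewrite exprS mulrA ler_wpM2r ?exprn_ge0 //; lra.
Qed.

Theorem theorem5p1 (R : realType) :
  \forall x \near +oo, x `^ (204 / 1000) < (zuckerman_count 10 x)%:R :> R.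
Proof.
pose e : R := 6 / 29 - 204 / 1000.
have e0 : 0 < e by rewrite /e; lra.
near=> x.
have x10 : 10 <= x by near: x; apply: nbhs_pinfty_ge; rewrite num_real.
have x0 : 0 < x by lra.
have xb : 165 `^ e^-1 < x by near: x; apply: nbhs_pinfty_gt; rewrite num_real.
have xe : 165 < x `^ e.
  have -> : 165 = (165 `^ e^-1) `^ e :> R.
    by rewrite -powRrM mulVf ?powRr1 ?gt_eqF.
  by rewrite gt0_ltr_powR ?nnegrE ?powR_ge0 ?(ltW x0).
have := zuckerman_count_powR x10.
have -> : 6 / 29 = 204 / 1000 + e :> R by rewrite /e; lra.
rewrite powRD; last by rewrite (gt_eqF x0) implybT.
have := powR_gt0 (204 / 1000) x0.
move: (x `^ (204 / 1000)) (x `^ e) xe (zuckerman_count 10 x)%:R => a q q165 c a0.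
have : a * 165 < a * q by rewrite ltr_pM2l.
by lra.
Unshelve. all: by end_near.
Qed.
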